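(* Let $\chi_0,\Gamma,I_{\rm in},\hbar>0$ be real constants, and for $\Omega_{\rm eff}>0$ define $$F(\Omega_{\rm eff})=\frac{\varrho_0^2}{I_{\rm r}}=\frac{4\chi_0^2\Gamma^4 I_{\rm in}}{\hbar^2}\exp\left(-\frac{\chi_0\Omega_{\rm eff}^2}{\Omega_{\rm eff}^2+\Gamma^2}\right)\frac{\Omega_{\rm eff}^2}{(\Omega_{\rm eff}^2+\Gamma^2)^4}.$$ Then the optimal (globally maximizing) $\Omega_{\rm eff}$ for the problem $\max_{\Omega_{\rm eff}>0}F(\Omega_{\rm eff})$ is $$\Omega_{\rm eff}^\star=\sqrt{\frac{\chi_0+4-\sqrt{\chi_0^2+4\chi_0+16}}{\chi_0-4+\sqrt{\chi_0^2+4\chi_0+16}}}\;\Gamma.$$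
   Context: The objective is the ''normalized global gain'' $\varrho_0^2/I_{\rm r}$, where, as functions of the effective Rabi frequency $\Omega_{\rm eff}>0$, $$I_{\rm r}=I_{\rm in}\exp\left(-\frac{\chi_0\Omega_{\rm eff}^2}{\Omega_{\rm eff}^2+\Gamma^2}\right),\qquad \varrho_0=\frac{2\chi_0\Gamma^2}{\hbar}\,I_{\rm r}\,\frac{\Omega_{\rm eff}}{(\Omega_{\rm eff}^2+\Gamma^2)^2}.$$ All of $\chi_0,\Gamma,I_{\rm in},\hbar$ are fixed positive real constants. *)

(* Defs.v *)
From Stdlib Require Import Reals.
Open Scope R_scope.

Definition Ir (chi0 Gamma Iin w : R) : R :=
  Iin * exp (- (chi0 * w ^ 2 / (w ^ 2 + Gamma ^ 2))).

Definition rho0 (chi0 Gamma Iin hbar w : R) : R :=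
  2 * chi0 * Gamma ^ 2 / hbar * Ir chi0 Gamma Iin w
  * (w / (w ^ 2 + Gamma ^ 2) ^ 2).

Definition normalized_gain (chi0 Gamma Iin hbar w : R) : R :=
  rho0 chi0 Gamma Iin hbar w ^ 2 / Ir chi0 Gamma Iin w.

Definition is_argmax_pos (f : R -> R) (x : R) : Prop :=
  0 < x /\ forall y : R, 0 < y -> f y <= f x.

(* For [chi0 > 0] one has [4 < sqrt (chi0 ^ 2 + 4 * chi0 + 16) < chi0 + 4], so
   the numerator and the denominator are both positive, and the conventions of
   [Rdiv] at 0 and of [sqrt] at negative reals play no role. *)
Definition Omega_opt (chi0 Gamma : R) : R :=
  sqrt ((chi0 + 4 - sqrt (chi0 ^ 2 + 4 * chi0 + 16))
        / (chi0 - 4 + sqrt (chi0 ^ 2 + 4 * chi0 + 16))) * Gamma.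

(* Main.v *)
Require Import Defs.
From Stdlib Require Import Reals.
From Stdlib Require Import Lra.
Open Scope R_scope.

(** In the variable [u = w^2 / (w^2 + Gamma^2)], which ranges over (0, 1), the
    gain is a positive constant times [exp (- chi0 u) u (1 - u)^3].  This
    function is log-concave, and the tangent-line bound [t <= exp (t - 1)],
    applied to [t = u / v] and [t = (1 - u) / (1 - v)], shows that its critical
    point [v], the smaller root of [chi0 v^2 - (chi0 + 4) v + 1 = 0], is its
    strict maximum. *)

Definition profile (c u : R) : R := exp (- (c * u)) * (u * (1 - u) ^ 3).

Definition saturation (Gamma w : R) : R := w ^ 2 / (w ^ 2 + Gamma ^ 2).

Lemma le_exp_sub1 (t : R) : t <= exp (t - 1).
Proof. pose proof (exp_ineq1_le (t - 1)); lra. Qed.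

Lemma lt_exp_sub1 (t : R) : t <> 1 -> t < exp (t - 1).
Proof. intros Ht; assert (H : t - 1 <> 0) by lra; apply exp_ineq1 in H; lra. Qed.

Lemma profile_lt_critical (c u v : R) :
  0 < u < 1 -> 0 < v < 1 -> c * v ^ 2 - (c + 4) * v + 1 = 0 -> u <> v ->
  profile c u < profile c v.
Proof.
  intros Hu Hv Hc Huv; unfold profile.
  set (a := u / v); set (b := (1 - u) / (1 - v)).
  assert (Ha : 0 < a) by (apply Rdiv_lt_0_compat; lra).
  assert (Hb : 0 < b) by (apply Rdiv_lt_0_compat; lra).
  assert (Ea : u = a * v) by (unfold a; field; lra).
  assert (Eb : 1 - u = b * (1 - v)) by (unfold b; field; lra).
  assert (Ha1 : a <> 1) by (intros E; apply Huv; rewrite Ea, E; ring).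
  (* The quadratic for [v], divided by [v * (1 - v)], says that the logarithmic derivative
     [1 / v - 3 / (1 - v) - c] of the profile vanishes at [v]. *)
  assert (Hcv : c = 1 / v - 3 / (1 - v)).
  { apply (Rmult_eq_reg_r (v * (1 - v))); [|nra].
    field_simplify; [nra | lra]. }
  (* Since [a - 1 = (u - v) / v] and [b - 1 = (v - u) / (1 - v)], the sum [(a - 1) + 3 * (b - 1)] is
     exactly [c * (u - v)]. *)
  assert (Eexp : exp (- (c * v)) =
                 exp (- (c * u)) * (exp (a - 1) * exp (b - 1) ^ 3)).
  { replace (exp (b - 1) ^ 3) with (exp (b - 1) * exp (b - 1) * exp (b - 1))
      by ring.
    rewrite <- !exp_plus; f_equal.
    rewrite Hcv; unfold a, b; field; lra. }
  (* Strictness comes from the factor [a] alone; the weak bound suffices for [b]. *)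
  assert (Hab : a * b ^ 3 < exp (a - 1) * exp (b - 1) ^ 3).
  { apply Rlt_le_trans with (exp (a - 1) * b ^ 3).
    - apply Rmult_lt_compat_r; [apply pow_lt; exact Hb | apply lt_exp_sub1, Ha1].
    - apply Rmult_le_compat_l; [left; apply exp_pos|].
      apply pow_incr; split; [lra | apply le_exp_sub1]. }
  replace (u * (1 - u) ^ 3) with (a * b ^ 3 * (v * (1 - v) ^ 3))
    by (rewrite Eb; rewrite Ea at 1; ring).
  rewrite Eexp, (Rmult_assoc (exp (- (c * u)))).
  apply Rmult_lt_compat_l; [apply exp_pos|].
  apply Rmult_lt_compat_r; [|exact Hab].
  apply Rmult_lt_0_compat; [lra | apply pow_lt; lra].
Qed.

Lemma saturation_bounds (Gamma w : R) :
  0 < Gamma -> 0 < w -> 0 < saturation Gamma w < 1.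
Proof.
  intros HG Hw; unfold saturation.
  pose proof (pow_lt w 2 Hw); pose proof (pow_lt Gamma 2 HG).
  split; [apply Rdiv_lt_0_compat; lra|].
  apply (Rmult_lt_reg_r (w ^ 2 + Gamma ^ 2)); [lra|].
  unfold Rdiv; rewrite Rmult_assoc, Rinv_l; lra.
Qed.

(** Cross-multiplying leaves [Gamma ^ 2 * (w ^ 2 - z ^ 2) = 0], and both points are positive. This
    carries uniqueness of the maximizer from [u] back to [w]. *)
Lemma saturation_inj (Gamma w z : R) :
  0 < Gamma -> 0 < w -> 0 < z -> saturation Gamma w = saturation Gamma z -> w = z.
Proof.
  intros HG Hw Hz E; unfold saturation in E.
  pose proof (pow_lt w 2 Hw); pose proof (pow_lt z 2 Hz).
  pose proof (pow_lt Gamma 2 HG).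
  assert (E2 : w ^ 2 * (z ^ 2 + Gamma ^ 2) = z ^ 2 * (w ^ 2 + Gamma ^ 2)).
  { apply (f_equal (fun t => t * (w ^ 2 + Gamma ^ 2) * (z ^ 2 + Gamma ^ 2))) in E.
    field_simplify in E; nra. }
  assert (w ^ 2 = z ^ 2) by nra.
  nra.
Qed.

Lemma normalized_gain_eq (chi0 Gamma Iin hbar w : R) :
  0 < Gamma -> 0 < Iin -> 0 < hbar -> 0 < w ->
  normalized_gain chi0 Gamma Iin hbar w =
  4 * chi0 ^ 2 * Gamma ^ 4 * Iin / hbar ^ 2
  * exp (- (chi0 * w ^ 2 / (w ^ 2 + Gamma ^ 2)))
  * (w ^ 2 / (w ^ 2 + Gamma ^ 2) ^ 4).
Proof.
  intros HG HI Hh Hw; unfold normalized_gain, rho0, Ir.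
  (* [rho0] is proportional to [Ir], so one of the two factors [e] cancels. *)
  set (e := exp _); assert (He : 0 < e) by apply exp_pos.
  field; repeat split; nra.
Qed.

(** As [1 - u = Gamma ^ 2 / (w ^ 2 + Gamma ^ 2)], the product [u * (1 - u) ^ 3] supplies
    [Gamma ^ 6], which turns the prefactor [Gamma ^ 4] into [1 / Gamma ^ 2]. *)
Lemma normalized_gain_profile (chi0 Gamma Iin hbar w : R) :
  0 < Gamma -> 0 < Iin -> 0 < hbar -> 0 < w ->
  normalized_gain chi0 Gamma Iin hbar w =
  4 * chi0 ^ 2 * Iin / (hbar ^ 2 * Gamma ^ 2)
  * profile chi0 (saturation Gamma w).
Proof.
  intros HG HI Hh Hw; rewrite normalized_gain_eq by assumption.
  unfold profile, saturation, Rdiv; rewrite <- (Rmult_assoc chi0 (w ^ 2)).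
  set (e := exp _).
  field; repeat split; nra.
Qed.

Lemma sqrt_disc_bounds (c : R) :
  0 < c -> 4 < sqrt (c ^ 2 + 4 * c + 16) < c + 4.
Proof.
  intros Hc.
  assert (Hs := sqrt_pos (c ^ 2 + 4 * c + 16)).
  assert (Hq := pow2_sqrt (c ^ 2 + 4 * c + 16) ltac:(nra)).
  split; nra.
Qed.

Lemma Omega_opt_pos (chi0 Gamma : R) :
  0 < chi0 -> 0 < Gamma -> 0 < Omega_opt chi0 Gamma.
Proof.
  intros Hc HG; pose proof (sqrt_disc_bounds chi0 Hc).
  apply Rmult_lt_0_compat; [|exact HG].
  apply sqrt_lt_R0, Rdiv_lt_0_compat; lra.
Qed.

(** If [w ^ 2 = p / q * Gamma ^ 2], the saturation is [p / (p + q)]; here [p + q = 2 * chi0] because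
    the square roots cancel. *)
Lemma saturation_Omega_opt (chi0 Gamma : R) :
  0 < chi0 -> 0 < Gamma ->
  saturation Gamma (Omega_opt chi0 Gamma) =
  (chi0 + 4 - sqrt (chi0 ^ 2 + 4 * chi0 + 16)) / (2 * chi0).
Proof.
  intros Hc HG; pose proof (sqrt_disc_bounds chi0 Hc).
  unfold saturation, Omega_opt.
  set (s := sqrt (chi0 ^ 2 + 4 * chi0 + 16)) in *.
  rewrite Rpow_mult_distr, pow2_sqrt by (left; apply Rdiv_lt_0_compat; lra).
  pose proof (Rmult_lt_0_compat _ _ Hc (pow_lt Gamma 2 HG)).
  field; repeat split; lra.
Qed.

Lemma saturation_Omega_opt_critical (chi0 Gamma : R) :
  0 < chi0 -> 0 < Gamma ->
  let v := saturation Gamma (Omega_opt chi0 Gamma) in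
  chi0 * v ^ 2 - (chi0 + 4) * v + 1 = 0.
Proof.
  intros Hc HG v; unfold v; rewrite saturation_Omega_opt by assumption.
  assert (Hq := pow2_sqrt (chi0 ^ 2 + 4 * chi0 + 16) ltac:(nra)).
  set (s := sqrt (chi0 ^ 2 + 4 * chi0 + 16)) in *.
  (* Completing the square: the discriminant is [(chi0 + 4) ^ 2 - 4 * chi0 = chi0 ^ 2 + 4 * chi0 +
     16]. *)
  replace (_ + 1) with ((s ^ 2 - (chi0 ^ 2 + 4 * chi0 + 16)) / (4 * chi0))
    by (field; lra).
  rewrite Hq; field; lra.
Qed.

Lemma normalized_gain_lt_opt (chi0 Gamma Iin hbar w : R) :
  0 < chi0 -> 0 < Gamma -> 0 < Iin -> 0 < hbar -> 0 < w ->
  w <> Omega_opt chi0 Gamma ->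
  normalized_gain chi0 Gamma Iin hbar w <
  normalized_gain chi0 Gamma Iin hbar (Omega_opt chi0 Gamma).
Proof.
  intros Hc HG HI Hh Hw Hne; pose proof (Omega_opt_pos chi0 Gamma Hc HG) as Ho.
  rewrite !normalized_gain_profile by assumption.
  apply Rmult_lt_compat_l.
  - apply Rdiv_lt_0_compat;
      repeat apply Rmult_lt_0_compat; try apply pow_lt; lra.
  - apply profile_lt_critical.
    + apply saturation_bounds; assumption.
    + apply saturation_bounds; assumption.
    + apply saturation_Omega_opt_critical; assumption.
    + intros E; apply Hne, (saturation_inj Gamma); assumption.
Qed.

Theorem theorem2 (chi0 Gamma Iin hbar : R)
  (hchi0 : 0 < chi0) (hGamma : 0 < Gamma) (hIin : 0 < Iin) (hhbar : 0 < hbar) :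
  (forall w : R, 0 < w ->
     normalized_gain chi0 Gamma Iin hbar w =
     4 * chi0 ^ 2 * Gamma ^ 4 * Iin / hbar ^ 2
     * exp (- (chi0 * w ^ 2 / (w ^ 2 + Gamma ^ 2)))
     * (w ^ 2 / (w ^ 2 + Gamma ^ 2) ^ 4))
  /\
  (forall w : R,
     is_argmax_pos (normalized_gain chi0 Gamma Iin hbar) w <->
     w = Omega_opt chi0 Gamma).
Proof.
  pose proof (Omega_opt_pos chi0 Gamma hchi0 hGamma) as Ho.
  split; [intros w Hw; apply normalized_gain_eq; assumption|].
  intros w; split.
  - intros [Hw Hmax].
    destruct (Req_dec w (Omega_opt chi0 Gamma)) as [E | Hne]; [exact E|].
    (* Any other maximizer would be strictly beaten by [Omega_opt], which is itself an admissible
       competitor. *)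
    exfalso; apply (Rlt_not_le _ _ (normalized_gain_lt_opt chi0 Gamma Iin hbar w
      hchi0 hGamma hIin hhbar Hw Hne)), Hmax, Ho.
  - intros ->; split; [exact Ho|]; intros y Hy.
    destruct (Req_dec y (Omega_opt chi0 Gamma)) as [-> | Hne]; [apply Rle_refl|].
    left; apply normalized_gain_lt_opt; assumption.
Qed.
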